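(* For $x=(x_1,x_2,x_3)\in\mathbb{C}^3$ the following conditions are equivalent: (0) $1-x_1z-x_2w+x_3zw\ne0$ for all $z,w\in\mathbb{D}$; (1) $x\in\overline{\mathbb{E}}$; (2) $\|\Psi(\cdot,x)\|_{H^\infty}\le1$ and, if $x_1x_2=x_3$, then in addition $|x_2|\le1$; (2$'$) $\|\Upsilon(\cdot,x)\|_{H^\infty}\le1$ and, if $x_1x_2=x_3$, then in addition $|x_1|\le1$; (3) $|x_1-\bar x_2x_3|+|x_1x_2-x_3|\le1-|x_2|^2$ and, if $x_1x_2=x_3$, then in addition $|x_1|\le1$; (3$'$) $|x_2-\bar x_1x_3|+|x_1x_2-x_3|\le1-|x_1|^2$ and, if $x_1x_2=x_3$, then in addition $|x_2|\le1$; (4) $|x_1|^2-|x_2|^2+|x_3|^2+2|x_2-\bar x_1x_3|\le1$ and $|x_2|\le1$; (4$'$) $-|x_1|^2+|x_2|^2+|x_3|^2+2|x_1-\bar x_2x_3|\le1$ and $|x_1|\le1$; (5) $|x_1|^2+|x_2|^2-|x_3|^2+2|x_1x_2-x_3|\le1$ and $|x_3|\le1$; (6) $|x_1-\bar x_2x_3|+|x_2-\bar x_1x_3|\le1-|x_3|^2$ and, if $|x_3|=1$, then in addition $|x_1|\le1$; (7) there exists a $2\times2$ complex matrix $A=[a_{ij}]$ such that $\|A\|\le1$ and $x=(a_{11},a_{22},\det A)$; (8) there exists a symmetric $2\times2$ complex matrix $A=[a_{ij}]$ such that $\|A\|\le1$ and $x=(a_{11},a_{22},\det A)$; (9) $|x_3|\le1$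 and there exist $\beta_1,\beta_2\in\mathbb{C}$ such that $|\beta_1|+|\beta_2|\le1$ and $x_1=\beta_1+\bar\beta_2x_3$, $x_2=\beta_2+\bar\beta_1x_3$.
   Context: $\mathbb{D}$ is the open unit disc. The tetrablock is $\mathbb{E}=\{x\in\mathbb{C}^3: 1-x_1z-x_2w+x_3zw\ne0 \text{ whenever } |z|\le1,\ |w|\le1\}$, and $\overline{\mathbb{E}}$ is its closure in $\mathbb{C}^3$. For $z\in\mathbb{C}$, $x\in\mathbb{C}^3$, $$\Psi(z,x)=\frac{x_3z-x_1}{x_2z-1},\qquad \Upsilon(z,x)=\Psi(z,x_2,x_1,x_3)=\frac{x_3z-x_2}{x_1z-1},$$ where, if $x_1x_2=x_3$, $\Psi(\cdot,x)$ is interpreted as the constant function $x_1$ and $\Upsilon(\cdot,x)$ as the constant function $x_2$. $\|\Psi(\cdot,x)\|_{H^\infty}=\sup_{z\in\mathbb{D}}|\Psi(z,x)|$; this is $+\infty$ if $x_1x_2\neq x_3$ and $|x_2|\ge1$ (similarly for $\Upsilon$ with $|x_1|\ge 1$). $\|A\|$ is the operator norm (largest singular value); symmetric means $A^T=A$. *)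

(* Defs.v *)
From HB Require Import structures.
From mathcomp Require Import all_boot all_order all_algebra.
From mathcomp Require Import all_real_closed.
From mathcomp Require Import all_classical all_reals all_analysis.

Set Implicit Arguments.
Unset Strict Implicit.
Unset Printing Implicit Defensive.

Import Order.TTheory GRing.Theory Num.Theory.
Import numFieldNormedType.Exports.

Local Open Scope classical_set_scope.
Local Open Scope complex_scope.
Local Open Scope ring_scope.

(* In R[i] the norm `|z| is itself an element of R[i] (with zero imaginary
   part), and u <= v means that v - u is a nonnegative real.  Suprema are taken
   in \bar R, so they need the R-valued modulus. *)
Definition modulus (R : realType) (z : R[i]) : R := complex.Re `|z|.

(* The carriers are R[i]^o because this alias of R[i], unlike R[i] itself,
   carries the topology induced by the modulus; closures in C^3 are then taken
   in the product topology. *)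
Definition tetrablock (R : realType) : set (R[i]^o * R[i]^o * R[i]^o) :=
  [set x : R[i] * R[i] * R[i] | let: (x1, x2, x3) := x in
    forall z w : R[i], `|z| <= 1 -> `|w| <= 1 ->
      1 - x1 * z - x2 * w + x3 * z * w != 0].

(* When x1 * x2 != x3, the value at the pole z = x2^-1 is 0, because division
   by 0 gives 0.  This does not affect suprema over the unit disc: the
   numerator does not vanish at the pole, so |Psi| is unbounded near it. *)
Definition Psi (R : realType) (x1 x2 x3 z : R[i]) : R[i] :=
  if x1 * x2 == x3 then x1 else (x3 * z - x1) / (x2 * z - 1).

Definition Upsilon (R : realType) (x1 x2 x3 z : R[i]) : R[i] :=
  Psi x2 x1 x3 z.

Definition Hinfnorm (R : realType) (f : R[i] -> R[i]) : \bar R :=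
  ereal_sup [set (modulus (f z))%:E | z in [set z : R[i] | `|z| < 1]].

Definition l2norm (R : realType) (n : nat) (v : 'cV[R[i]]_n) : R :=
  Num.sqrt (\sum_i modulus (v i 0) ^+ 2).

Definition opnorm (R : realType) (m n : nat) (A : 'M[R[i]]_(m, n)) : \bar R :=
  ereal_sup [set (l2norm (A *m v))%:E | v in [set v | l2norm v <= 1]].

(* Main.v *)
Require Import Defs.
From HB Require Import structures.
From mathcomp Require Import all_boot all_order all_algebra.
From mathcomp Require Import all_real_closed.
From mathcomp Require Import all_classical all_reals all_analysis.
From mathcomp Require Import ring lra.

Import Order.TTheory GRing.Theory Num.Theory.
Import numFieldNormedType.Exports.

Local Open Scope classical_set_scope.
Local Open Scope complex_scope.
Local Open Scope ring_scope.

(* Write a, b, c for |x1|, |x2|, |x3| and t for Re (x1 x2 conj x3), so |t| <= a b c.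
   The three quantities p = |x1 x2 - x3|, q = |x1 - conj x2 x3| and
   s = |x2 - conj x1 x3| satisfy p^2 = a^2 b^2 + c^2 - 2 t and its images under
   permutations of a, b, c.  Conditions (3)-(6) thus become inequalities in
   (a, b, c, t), all equivalent to one system that is symmetric in a, b, c;
   squaring works because p^2 - q^2 = (c^2 - a^2)(1 - b^2).

   (0), (1) and (2) all amount to |x2| <= 1 and |x3 w - x1| <= |x2 w - 1| for
   |w| < 1.  On the unit circle this is (4); the interior follows since
   |x2 w - 1|^2 - |x3 w - x1|^2 is bounded below by a quadratic polynomial in |w|
   which factors explicitly.  The closure is reached through
   (r x1, r x2, r^2 x3), r < 1.

   For (8), take the symmetric matrix with off-diagonal entry a square root of
   x1 x2 - x3: its defect 1 - A* A has determinant
   1 - a^2 - b^2 - 2 p + c^2, nonnegative by (5).  (7) gives (0) because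
   1 - x1 z - x2 w + x3 z w = det (1 - A diag(z, w)).  Solving the linear system
   of (9) for beta_1, beta_2 gives (x1 - conj x2 x3) / (1 - c^2) and
   (x2 - conj x1 x3) / (1 - c^2), so (9) is (6). *)

(** * Real inequalities in the moduli and one real part *)

(* The last inequality is (2 p)^2 <= (1 - a^2 - b^2 + c^2)^2; expanded, it is
   symmetric in a, b, c. *)
Definition feas {R : realFieldType} (a b c t : R) : Prop :=
  [/\ a + b <= 1 + c, a + c <= 1 + b, b + c <= 1 + a &
      4 * a ^+ 2 * b ^+ 2 + 4 * c ^+ 2 - (1 - a ^+ 2 - b ^+ 2 + c ^+ 2) ^+ 2
        <= 8 * t].

Lemma feas_swap12 (R : realFieldType) (a b c t : R) :
  feas a b c t -> feas b a c t.
Proof. by case=> h1 h2 h3 h4; split; lra. Qed.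

Lemma feas_swap23 (R : realFieldType) (a b c t : R) :
  feas a b c t -> feas a c b t.
Proof. by case=> h1 h2 h3 h4; split; lra. Qed.

Lemma between_of_sqr_le (R : realFieldType) (x p : R) :
  0 <= p -> x ^+ 2 <= p ^+ 2 -> - p <= x <= p.
Proof.
by move=> p0; rewrite -real_normK ?num_real // ler_sqr ?nnegrE // ler_norml.
Qed.

(** Since [t <= a * b * c], [p] is at least [|a * b - c|]. This gives [(a + b) ^+ 2 <= (1 + c) ^+ 2]
    and [(a - b) ^+ 2 <= (1 - c) ^+ 2], which for [c <= 1] are the linear inequalities of [feas]. *)
Lemma feas_double (R : realFieldType) (a b c t p : R) :
  0 <= a -> 0 <= b -> 0 <= c -> 0 <= p -> t <= a * b * c -> - (a * b * c) <= t ->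
  p ^+ 2 = a ^+ 2 * b ^+ 2 + c ^+ 2 - 2 * t ->
  (a ^+ 2 + b ^+ 2 - c ^+ 2 + 2 * p <= 1 /\ c <= 1) <-> feas a b c t.
Proof.
move=> a0 b0 c0 p0 tu tl pE; split=> [[h c1]|[h1 h2 h3 h4]].
- have /andP[pl pu] : - p <= a * b - c <= p by apply: between_of_sqr_le; lra.
  have e1 : (a + b) ^+ 2 <= (1 + c) ^+ 2 by nra.
  have e2 : (a - b) ^+ 2 <= (1 - c) ^+ 2 by nra.
  split; [nra | nra | nra |].
  have : (2 * p) ^+ 2 <= (1 - a ^+ 2 - b ^+ 2 + c ^+ 2) ^+ 2 by nra.
  lra.
- split; last by lra.
  (* Half the sum of the squares of [a + b <= 1 + c] and [|a - b| <= 1 - c]. *)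
  have d0 : 0 <= 1 - a ^+ 2 - b ^+ 2 + c ^+ 2.
    nra.
  have : (2 * p) ^+ 2 <= (1 - a ^+ 2 - b ^+ 2 + c ^+ 2) ^+ 2 by lra.
  nra.
Qed.

(** For [b = 1] the inequality only forces [p = q = 0] and [a = c], leaving [a] unbounded; hence the
    extra clause. *)
Lemma feas_sum (R : realFieldType) (a b c t p q : R) :
  0 <= a -> 0 <= b -> 0 <= c -> 0 <= p -> 0 <= q ->
  t <= a * b * c -> - (a * b * c) <= t ->
  p ^+ 2 = a ^+ 2 * b ^+ 2 + c ^+ 2 - 2 * t ->
  q ^+ 2 = a ^+ 2 + b ^+ 2 * c ^+ 2 - 2 * t ->
  (q + p <= 1 - b ^+ 2 /\ (b = 1 -> a <= 1)) <-> feas a b c t.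
Proof.
move=> a0 b0 c0 p0 q0 tu tl pE qE; split=> [[h ab]|h].
- have b1 : b <= 1 by nra.
  have [bE|nb] := eqVneq b 1.
    have := ab bE; move: h pE qE tu tl; rewrite bE => h pE qE tu tl a1.
    have p00 : p = 0 by lra.
    have q00 : q = 0 by lra.
    have ac : a = c by move: pE qE; rewrite p00 q00; nra.
    by split; nra.
  have {nb b1} b1 : 0 < 1 - b by rewrite subr_gt0 lt_neqAle nb.
  have u0 : 0 < 1 - b ^+ 2 by nra.
  have dE : q ^+ 2 - p ^+ 2 = (a ^+ 2 - c ^+ 2) * (1 - b ^+ 2) by rewrite pE qE; ring.
  (* With [u = 1 - b ^+ 2], squaring [q <= u - p] gives [q ^+ 2 - p ^+ 2 <= u * (u - 2 * p)], and by
     [dE] a factor [u] cancels. Exchanging [p] and [q] gives [h2]. *)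
  have h1 : (1 - b ^+ 2) * (a ^+ 2 - c ^+ 2) <= (1 - b ^+ 2) * (1 - b ^+ 2 - 2 * p).
    nra.
  have h2 : (1 - b ^+ 2) * (c ^+ 2 - a ^+ 2) <= (1 - b ^+ 2) * (1 - b ^+ 2 - 2 * q).
    nra.
  rewrite !ler_pM2l // in h1 h2.
  have c1 : c <= 1.
    have /andP[pl pu] : - p <= a * b - c <= p by apply: between_of_sqr_le; lra.
    have /andP[ql qu] : - q <= a - b * c <= q by apply: between_of_sqr_le; lra.
    (* If [c > 1], the negative number [1 - a + b - c] divides both [(1 - c) ^+ 2 - (a - b) ^+ 2]
       and [(1 - a) ^+ 2 - (b - c) ^+ 2], which are nonnegative. Both cofactors are then
       nonpositive, yet their sum is [2 - 2 * b > 0]. *)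
    rewrite leNgt; apply/negP => c1.
    have Y2 : 0 <= 1 - c + a - b by nra.
    have X : 1 - a + b - c < 0 by lra.
    have XY2 : 0 <= (1 - a + b - c) * (1 - c + a - b) by lra.
    have XY1 : 0 <= (1 - a + b - c) * (1 - a - b + c) by lra.
    rewrite nmulr_rge0 // in XY2; rewrite nmulr_rge0 // in XY1.
    lra.
  by apply/(@feas_double _ a b c t p) => //; split => //; lra.
- have [h1 h2 h3 h4] := h.
  (* By the symmetry of [feas], [feas_double] applies with [c] and with [a] in the last place; the
     two inequalities add up to twice the claim. *)
  have [pp _] : a ^+ 2 + b ^+ 2 - c ^+ 2 + 2 * p <= 1 /\ c <= 1.
    exact/(@feas_double _ a b c t p).
  have [qq _] : b ^+ 2 + c ^+ 2 - a ^+ 2 + 2 * q <= 1 /\ a <= 1.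
    apply/(@feas_double _ b c a t q); rewrite ?pE ?qE //; last by split; lra.
    - by lra.
    - by lra.
    - by ring.
  by split; [lra | lra].
Qed.

(* With u = 1 - a^2, u times the difference of the two sides is (u - s r)^2 - (p r)^2. *)
Lemma feas_disc (R : realFieldType) (a b c t p s r : R) :
  0 <= a -> 0 <= b -> 0 <= c -> 0 <= p -> 0 <= s -> 0 <= r <= 1 ->
  t <= a * b * c -> - (a * b * c) <= t ->
  p ^+ 2 = a ^+ 2 * b ^+ 2 + c ^+ 2 - 2 * t ->
  s ^+ 2 = b ^+ 2 + a ^+ 2 * c ^+ 2 - 2 * t ->
  feas a b c t ->
  2 * s * r <= (1 - a ^+ 2) + (b ^+ 2 - c ^+ 2) * r ^+ 2.
Proof.
move=> a0 b0 c0 p0 s0 /andP[r0 r1] tu tl pE sE h.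
have [h1 h2 h3 h4] := h.
have [sp _] : s + p <= 1 - a ^+ 2 /\ (a = 1 -> b <= 1).
  apply/(@feas_sum _ b a c t p s); rewrite ?pE ?sE //; [lra|lra|ring|].
  exact: feas_swap12.
have [aE|na] := eqVneq a 1.
  move: sp h2 h3; rewrite aE => sp h2 h3.
  have -> : s = 0 by lra.
  have -> : b = c by lra.
  lra.
have a1 : 0 < 1 - a by rewrite subr_gt0 lt_neqAle na /=; lra.
have u0 : 0 < 1 - a ^+ 2 by nra.
have dE : s ^+ 2 - p ^+ 2 = (b ^+ 2 - c ^+ 2) * (1 - a ^+ 2) by rewrite pE sE; ring.
rewrite -subr_ge0 -(pmulr_rge0 _ u0).
have -> : (1 - a ^+ 2) * (1 - a ^+ 2 + (b ^+ 2 - c ^+ 2) * r ^+ 2 - 2 * s * r) =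
  (1 - a ^+ 2 - (s + p) * r) * (1 - a ^+ 2 - s * r + p * r).
  transitivity ((1 - a ^+ 2) ^+ 2 - 2 * s * r * (1 - a ^+ 2) +
    r ^+ 2 * ((b ^+ 2 - c ^+ 2) * (1 - a ^+ 2))); first by ring.
  by rewrite -dE; ring.
have e : (s + p) * r <= 1 - a ^+ 2 by nra.
by apply: mulr_ge0; nra.
Qed.

Lemma quad_left_lim (R : realFieldType) (A B C r0 : R) : 0 < r0 ->
  (forall r, 0 <= r -> r < r0 -> 0 <= A + B * r + C * r ^+ 2) ->
  0 <= A + B * r0 + C * r0 ^+ 2.
Proof.
move=> r00 h; apply/ler_addgt0Pr => e e0.
(* [M - 1] is a Lipschitz constant of the polynomial on [[0, r0]]; adding 1 keeps [M] positive. *)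
set M := `|B| + 2 * `|C| * r0 + 1.
have M0 : 0 < M by rewrite /M; have := normr_ge0 B; have := normr_ge0 C; nra.
pose d := Num.min (e / M) r0.
have d0 : 0 < d by rewrite lt_min divr_gt0.
have de : d * M <= e by rewrite -ler_pdivlMr // ge_min lexx.
have dr : d <= r0 by rewrite ge_min lexx orbT.
have := h (r0 - d); rewrite subr_ge0 => /(_ dr).
rewrite gtrBl => /(_ d0) h1.
have hB : - (`|B| * d) <= B * d by rewrite -mulNr ler_wpM2r ?(ltW d0) // lerNl -normrN ler_norm.
have hC : - (`|C| * (2 * r0 * d)) <= C * (2 * r0 * d - d ^+ 2).
  have : 0 <= d * (2 * r0 - d) by rewrite mulr_ge0 ?ltW //; lra.
  have : - `|C| <= C by rewrite lerNl -normrN ler_norm.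
  have : 0 <= `|C| * d ^+ 2 by rewrite mulr_ge0 ?normr_ge0 // sqr_ge0.
  nra.
rewrite /M in de; lra.
Qed.

(** * The modulus as a real number *)

Lemma normr_modulus (R : realType) (z : R[i]) : `|z| = (modulus z)%:C.
Proof. by rewrite /modulus normc_def. Qed.

Lemma modulus_ge0 (R : realType) (z : R[i]) : 0 <= modulus z.
Proof. by rewrite -lecR -normr_modulus normr_ge0. Qed.

Lemma sqr_modulus (R : realType) (z : R[i]) :
  modulus z ^+ 2 = complex.Re z ^+ 2 + complex.Im z ^+ 2.
Proof. by apply: complexI; rewrite rmorphXn /= -normr_modulus -add_Re2_Im2. Qed.

Lemma modulusM (R : realType) (z w : R[i]) : modulus (z * w) = modulus z * modulus w.
Proof. by apply: complexI; rewrite rmorphM /= -!normr_modulus normrM. Qed.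

Lemma modulusV (R : realType) (z : R[i]) : modulus z^-1 = (modulus z)^-1.
Proof. by apply: complexI; rewrite fmorphV /= -!normr_modulus normfV. Qed.

Lemma modulusN (R : realType) (z : R[i]) : modulus (- z) = modulus z.
Proof. by rewrite /modulus normrN. Qed.

Lemma modulusB (R : realType) (z w : R[i]) : modulus (z - w) = modulus (w - z).
Proof. by rewrite /modulus distrC. Qed.

Lemma modulusD (R : realType) (z w : R[i]) :
  modulus (z + w) <= modulus z + modulus w.
Proof. by rewrite -lecR rmorphD /= -!normr_modulus ler_normD. Qed.

Lemma modulus_conj (R : realType) (z : R[i]) : modulus z^* = modulus z.
Proof. by rewrite /modulus norm_conjC. Qed.

Lemma modulus_real (R : realType) (r : R) : 0 <= r -> modulus r%:C = r.
Proof. by move=> r0; rewrite /modulus ger0_norm // ler0c. Qed.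

Lemma modulus1 (R : realType) : modulus (1 : R[i]) = 1.
Proof. by rewrite /modulus normr1. Qed.

Lemma modulus0 (R : realType) : modulus (0 : R[i]) = 0.
Proof. by rewrite /modulus normr0. Qed.

Lemma modulus_eq0 (R : realType) (z : R[i]) : (modulus z == 0) = (z == 0).
Proof. by rewrite -[RHS]normr_eq0 normr_modulus -(inj_eq (@complexI R)). Qed.

Lemma Re_le_modulus (R : realType) (z : R[i]) : complex.Re z <= modulus z.
Proof.
have := normc_ge_Re z; rewrite normr_modulus lecR; exact: le_trans (ler_norm _).
Qed.

Lemma normr_le_real (R : realType) (z : R[i]) (r : R) : (`|z| <= r%:C) = (modulus z <= r).
Proof. by rewrite normr_modulus lecR. Qed.

Lemma normr_lt_real (R : realType) (z : R[i]) (r : R) : (`|z| < r%:C) = (modulus z < r).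
Proof. by rewrite normr_modulus ltcR. Qed.

Lemma normr_le1 (R : realType) (z : R[i]) : (`|z| <= 1) = (modulus z <= 1).
Proof. exact: normr_le_real. Qed.

Lemma normr_lt1 (R : realType) (z : R[i]) : (`|z| < 1) = (modulus z < 1).
Proof. exact: normr_lt_real. Qed.

(** Carries inequalities between real elements of [R[i]] over to [R], where [lra] and [nra]
    apply. *)
Lemma le_real_complex (R : realType) (u v : R) (U V : R[i]) :
  U = u%:C -> V = v%:C -> (U <= V) = (u <= v).
Proof. by move=> -> ->; rewrite lecR. Qed.

Definition real_complexE := (rmorphD, rmorphB, rmorphN, rmorphM, rmorphXn, rmorph1, rmorph_nat).

(** * Conditions (3) to (6) as real inequalities *)

Lemma sqr_modulus_det (R : realType) (x1 x2 x3 : R[i]) :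
  modulus (x1 * x2 - x3) ^+ 2 =
  modulus x1 ^+ 2 * modulus x2 ^+ 2 + modulus x3 ^+ 2
    - 2 * complex.Re (x1 * x2 * x3^*).
Proof.
rewrite !sqr_modulus; case: x1 x2 x3 => [a1 a2] [b1 b2] [c1 c2] /=; ring.
Qed.

Lemma sqr_modulus_sub_conj (R : realType) (x1 x2 x3 : R[i]) :
  modulus (x1 - x2^* * x3) ^+ 2 =
  modulus x1 ^+ 2 + modulus x2 ^+ 2 * modulus x3 ^+ 2
    - 2 * complex.Re (x1 * x2 * x3^*).
Proof.
rewrite !sqr_modulus; case: x1 x2 x3 => [a1 a2] [b1 b2] [c1 c2] /=; ring.
Qed.

Lemma Re_triple_le (R : realType) (x1 x2 x3 : R[i]) :
  complex.Re (x1 * x2 * x3^*) <= modulus x1 * modulus x2 * modulus x3.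
Proof. by apply: le_trans (Re_le_modulus _ _) _; rewrite !modulusM modulus_conj. Qed.

Lemma Re_triple_ge (R : realType) (x1 x2 x3 : R[i]) :
  - (modulus x1 * modulus x2 * modulus x3) <= complex.Re (x1 * x2 * x3^*).
Proof.
have := Re_triple_le R (- x1) x2 x3; rewrite modulusN !mulNr.
by rewrite lerNl; case: (x1 * x2 * _).
Qed.

Definition tetrafeas {R : realType} (x1 x2 x3 : R[i]) : Prop :=
  feas (modulus x1) (modulus x2) (modulus x3) (complex.Re (x1 * x2 * x3^*)).

Lemma tetrafeasC (R : realType) (x1 x2 x3 : R[i]) :
  tetrafeas x1 x2 x3 <-> tetrafeas x2 x1 x3.
Proof. by rewrite /tetrafeas [x2 * x1]mulrC; split; exact: feas_swap12. Qed.

Lemma tetrafeas_le1 (R : realType) (x1 x2 x3 : R[i]) :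
  tetrafeas x1 x2 x3 -> [/\ modulus x1 <= 1, modulus x2 <= 1 & modulus x3 <= 1].
Proof. by case=> h1 h2 h3 _; split; lra. Qed.

Lemma cond5_feas (R : realType) (x1 x2 x3 : R[i]) :
  (`|x1| ^+ 2 + `|x2| ^+ 2 - `|x3| ^+ 2 + 2 * `|x1 * x2 - x3| <= 1 /\ `|x3| <= 1)
  <-> tetrafeas x1 x2 x3.
Proof.
rewrite normr_le1 (@le_real_complex _ (modulus x1 ^+ 2 + modulus x2 ^+ 2
  - modulus x3 ^+ 2 + 2 * modulus (x1 * x2 - x3)) 1) //; last first.
  by rewrite !normr_modulus !real_complexE.
by apply: feas_double; rewrite ?modulus_ge0 ?Re_triple_le ?Re_triple_ge ?sqr_modulus_det.
Qed.

(** With the real part fixed, exchanging [|x2|] and [|x3|] turns the formula for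
    [|x1 * x2 - x3| ^+ 2] into that for [|x2 - x1^* * x3| ^+ 2], so [feas_double] applies. *)
Lemma cond4_feas (R : realType) (x1 x2 x3 : R[i]) :
  (`|x1| ^+ 2 - `|x2| ^+ 2 + `|x3| ^+ 2 + 2 * `|x2 - x1^* * x3| <= 1 /\ `|x2| <= 1)
  <-> tetrafeas x1 x2 x3.
Proof.
rewrite normr_le1 (@le_real_complex _ (modulus x1 ^+ 2 + modulus x3 ^+ 2
  - modulus x2 ^+ 2 + 2 * modulus (x2 - x1^* * x3)) 1) //; last first.
  by rewrite !normr_modulus !real_complexE; ring.
have E := feas_swap23.
apply: (iff_trans (B := feas (modulus x1) (modulus x3) (modulus x2)
  (complex.Re (x1 * x2 * x3^*)))); last by split; exact: E.
apply: feas_double; rewrite ?modulus_ge0 // ?[_ * modulus x3 * _]mulrAC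
  ?Re_triple_le ?Re_triple_ge //.
by rewrite sqr_modulus_sub_conj [x2 * x1]mulrC; ring.
Qed.

Lemma cond3_feas (R : realType) (x1 x2 x3 : R[i]) :
  (`|x1 - x2^* * x3| + `|x1 * x2 - x3| <= 1 - `|x2| ^+ 2 /\
    (x1 * x2 = x3 -> `|x1| <= 1))
  <-> tetrafeas x1 x2 x3.
Proof.
rewrite normr_le1 (@le_real_complex _ (modulus (x1 - x2^* * x3) +
  modulus (x1 * x2 - x3)) (1 - modulus x2 ^+ 2)) //; first last.
- by rewrite !normr_modulus !real_complexE.
- by rewrite !normr_modulus !real_complexE.
have q0 := modulus_ge0 _ (x1 - x2^* * x3); have p0 := modulus_ge0 _ (x1 * x2 - x3).
have E : (modulus (x1 - x2^* * x3) + modulus (x1 * x2 - x3) <= 1 - modulus x2 ^+ 2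
    /\ (modulus x2 = 1 -> modulus x1 <= 1)) <-> tetrafeas x1 x2 x3.
  apply: feas_sum;
    by rewrite ?modulus_ge0 ?Re_triple_le ?Re_triple_ge ?sqr_modulus_det ?sqr_modulus_sub_conj.
split=> [[h h']|h].
(* [|x2| = 1] makes the right side 0, so [x1 * x2 = x3] and the clause on [x1] becomes available. *)
- apply/E; split=> // b1; apply: h'; apply/eqP; rewrite -subr_eq0 -modulus_eq0.
  rewrite b1 in h; apply/eqP; lra.
- by have [a1 _ _] := tetrafeas_le1 _ _ _ _ h; split=> //; exact: (proj1 (proj2 E h)).
Qed.

Lemma cond6_feas (R : realType) (x1 x2 x3 : R[i]) :
  (`|x1 - x2^* * x3| + `|x2 - x1^* * x3| <= 1 - `|x3| ^+ 2 /\
    (`|x3| = 1 -> `|x1| <= 1))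
  <-> tetrafeas x1 x2 x3.
Proof.
rewrite normr_le1 (@le_real_complex _ (modulus (x1 - x2^* * x3) +
  modulus (x2 - x1^* * x3)) (1 - modulus x3 ^+ 2)) //; first last.
- by rewrite !normr_modulus !real_complexE.
- by rewrite !normr_modulus !real_complexE.
have -> : (`|x3| = 1) = (modulus x3 = 1).
  by rewrite normr_modulus; apply/propext; split=> [/complexI|->].
have E := feas_swap23.
apply: (iff_trans (B := feas (modulus x1) (modulus x3) (modulus x2)
  (complex.Re (x1 * x2 * x3^*)))); last by split; exact: E.
apply: feas_sum; rewrite ?modulus_ge0 // ?[_ * modulus x3 * _]mulrAC
  ?Re_triple_le ?Re_triple_ge //.
- by rewrite sqr_modulus_sub_conj [x2 * x1]mulrC; ring.
- by rewrite sqr_modulus_sub_conj; ring.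
Qed.

(** * The contractive inequality on the disc; conditions (0) and (2) *)

(** The argument of [w] enters only through the real part, so on each circle the minimum is where
    that part equals [|w| * |x2 - x1^* * x3|]. *)
Lemma modulus_diff (R : realType) (x1 x2 x3 w : R[i]) :
  modulus (x2 * w - 1) ^+ 2 - modulus (x3 * w - x1) ^+ 2 =
  1 - modulus x1 ^+ 2 - 2 * complex.Re (w * (x2 - x1^* * x3))
    + (modulus x2 ^+ 2 - modulus x3 ^+ 2) * modulus w ^+ 2.
Proof.
rewrite !sqr_modulus.
case: x1 x2 x3 w => [a1 a2] [b1 b2] [c1 c2] [w1 w2] /=; ring.
Qed.

Lemma real_rotation (R : realType) (y : R[i]) :
  exists2 u : R[i], modulus u = 1 & complex.Re (u * y) = modulus y.
Proof.
have [->|y0] := eqVneq y 0.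
  by exists 1; rewrite ?modulus1 // mulr0 modulus0.
have n0 : modulus y != 0 by rewrite modulus_eq0.
exists ((modulus y)^-1%:C * y^*).
  by rewrite modulusM modulus_conj modulus_real ?invr_ge0 ?modulus_ge0 // mulVf.
rewrite -mulrA [y^* * y]mulrC -sqr_normc normr_modulus -rmorphXn -rmorphM /=.
by rewrite expr2 mulKf.
Qed.

(** The bound 1 on [Psi] cleared of its denominator; [|x2| <= 1] keeps the pole out of the open
    disc. *)
Definition disc_contractive {R : realType} (x1 x2 x3 : R[i]) : Prop :=
  modulus x2 <= 1 /\
  forall w : R[i], modulus w < 1 -> modulus (x3 * w - x1) <= modulus (x2 * w - 1).

(* Used at w = 1 / x2, the pole of Psi, to see that the numerator vanishes there too. *)
Lemma disc_radial_limit (R : realType) (x1 x2 x3 w : R[i]) :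
  (forall r : R, 0 <= r -> r < 1 ->
    modulus (x3 * (r%:C * w) - x1) <= modulus (x2 * (r%:C * w) - 1)) ->
  modulus (x3 * w - x1) <= modulus (x2 * w - 1).
Proof.
move=> h; rewrite -ler_sqr ?nnegrE ?modulus_ge0 // -subr_ge0 modulus_diff.
have := quad_left_lim R (1 - modulus x1 ^+ 2) (- 2 * complex.Re (w * (x2 - x1^* * x3)))
  ((modulus x2 ^+ 2 - modulus x3 ^+ 2) * modulus w ^+ 2) 1 ltr01.
rewrite !mulr1 expr1n !mulr1 mulNr; apply => r r0 r1.
have := h r r0 r1; rewrite -ler_sqr ?nnegrE ?modulus_ge0 // -subr_ge0 modulus_diff.
rewrite modulusM modulus_real // -mulrA.
have -> : complex.Re (r%:C * (w * (x2 - x1^* * x3))) = r * complex.Re (w * (x2 - x1^* * x3)).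
  by case: (w * _) => a b /=; ring.
by rewrite exprMn; lra.
Qed.

Lemma disc_contractive_feas (R : realType) (x1 x2 x3 : R[i]) :
  disc_contractive x1 x2 x3 <-> tetrafeas x1 x2 x3.
Proof.
split=> [[b1 h]|h].
- apply/cond4_feas; rewrite normr_le1; split=> //.
  rewrite (@le_real_complex _ (modulus x1 ^+ 2 - modulus x2 ^+ 2 + modulus x3 ^+ 2
    + 2 * modulus (x2 - x1^* * x3)) 1) //; last by rewrite !normr_modulus !real_complexE.
  (* This [u] minimizes the difference on the unit circle, which is reached as a radial limit. *)
  have [u u1 uE] := real_rotation R (x2 - x1^* * x3).
  have : modulus (x3 * u - x1) <= modulus (x2 * u - 1).
    apply: disc_radial_limit => r r0 r1; apply: h.
    by rewrite modulusM u1 mulr1 modulus_real.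
  rewrite -ler_sqr ?nnegrE ?modulus_ge0 // -subr_ge0 modulus_diff uE u1; lra.
- have [_ b1 _] := tetrafeas_le1 _ _ _ _ h; split=> // w w1.
  rewrite -ler_sqr ?nnegrE ?modulus_ge0 // -subr_ge0 modulus_diff.
  have sE := sqr_modulus_sub_conj R x2 x1 x3; rewrite [x2 * x1]mulrC in sE.
  have := feas_disc R _ _ _ _ _ _ (modulus w) (modulus_ge0 _ x1) (modulus_ge0 _ x2)
    (modulus_ge0 _ x3) (modulus_ge0 _ (x1 * x2 - x3)) (modulus_ge0 _ (x2 - x1^* * x3))
    _ (Re_triple_le R x1 x2 x3) (Re_triple_ge R x1 x2 x3) (sqr_modulus_det R x1 x2 x3) sE h.
  rewrite modulus_ge0 ltW // => /(_ isT).
  have := Re_le_modulus R (w * (x2 - x1^* * x3)); rewrite modulusM; lra.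
Qed.

Lemma modulus_lt1_ne1 (R : realType) (z : R[i]) : modulus z < 1 -> z - 1 != 0.
Proof. by move=> z1; rewrite subr_eq0; apply/eqP => zE; rewrite zE modulus1 ltxx in z1. Qed.

(** For fixed [w] the expression is affine in [z]; its zero [(x2 * w - 1) / (x3 * w - x1)], when
    defined, must stay out of the disc. *)
Lemma cond0_disc (R : realType) (x1 x2 x3 : R[i]) :
  (forall z w : R[i], `|z| < 1 -> `|w| < 1 -> 1 - x1 * z - x2 * w + x3 * z * w != 0)
  <-> disc_contractive x1 x2 x3.
Proof.
have E z w : 1 - x1 * z - x2 * w + x3 * z * w = z * (x3 * w - x1) - (x2 * w - 1) by ring.
split=> [h|[b1 h] z w].
- have b1 : modulus x2 <= 1.
    rewrite leNgt; apply/negP => b1.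
    have x20 : x2 != 0 by rewrite -modulus_eq0 gt_eqF // (lt_trans ltr01).
    have := h 0 x2^-1; rewrite normr0 ltr01 normr_lt1 modulusV invf_lt1 ?(lt_trans ltr01) //.
    by move=> /(_ isT b1); rewrite E mul0r mulfV // subrr subrr eqxx.
  split=> // w w1; rewrite leNgt; apply/negP => lt.
  have n0 : x3 * w - x1 != 0.
    by rewrite -modulus_eq0 gt_eqF // (le_lt_trans (modulus_ge0 _ _) lt).
  have := h ((x2 * w - 1) / (x3 * w - x1)) w.
  rewrite !normr_lt1 modulusM modulusV ltr_pdivrMr; last first.
    by rewrite lt_neqAle modulus_ge0 eq_sym modulus_eq0 n0.
  by rewrite mul1r => /(_ lt w1); rewrite E divfK // subrr eqxx.
- rewrite !normr_lt1 => z1 w1; rewrite E subr_eq0; apply/eqP => zE.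
  have d0 : x2 * w - 1 != 0.
    apply: modulus_lt1_ne1; rewrite modulusM.
    by apply: le_lt_trans w1; rewrite ler_piMl ?modulus_ge0.
  have dpos : 0 < modulus (x2 * w - 1) by rewrite lt_neqAle modulus_ge0 eq_sym modulus_eq0 d0.
  have := h w w1; rewrite leNgt => /negP; apply; rewrite -zE modulusM.
  have npos : 0 < modulus (x3 * w - x1).
    rewrite lt_neqAle modulus_ge0 eq_sym modulus_eq0 andbT.
    by apply: contraNneq d0 => n0; rewrite -zE n0 mulr0.
  by rewrite gtr_pMl.
Qed.

Lemma Hinfnorm_le1P (R : realType) (f : R[i] -> R[i]) :
  (Hinfnorm f <= 1)%E <-> forall z, modulus z < 1 -> modulus (f z) <= 1.
Proof.
split=> [h z z1|h].
- rewrite -lee_fin; apply: le_trans h; apply: ereal_sup_ubound.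
  by exists z => //=; rewrite normr_lt1.
- apply: ge_ereal_sup => _ [z /= z1 <-]; rewrite lee_fin; apply: h.
  by rewrite -normr_lt1.
Qed.

Lemma cond2_disc (R : realType) (x1 x2 x3 : R[i]) :
  ((Hinfnorm (Psi x1 x2 x3) <= 1)%E /\ (x1 * x2 = x3 -> `|x2| <= 1))
  <-> disc_contractive x1 x2 x3.
Proof.
split=> [[/Hinfnorm_le1P h h']|h].
- have [E|E] := eqVneq (x1 * x2) x3.
    have a1 : modulus x1 <= 1.
      by have := h 0; rewrite modulus0 /Psi E eqxx; apply.
    split=> [|w w1]; first by rewrite -normr_le1 h'.
    have -> : x3 * w - x1 = x1 * (x2 * w - 1) by rewrite -E; ring.
    by rewrite modulusM ler_piMl ?modulus_ge0.
  have {}h z : modulus z < 1 -> x2 * z - 1 != 0 ->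
      modulus (x3 * z - x1) <= modulus (x2 * z - 1).
    move=> z1 d0; have := h z z1; rewrite /Psi (negbTE E) modulusM modulusV.
    rewrite ler_pdivrMr ?mul1r //.
    by rewrite lt_neqAle modulus_ge0 eq_sym modulus_eq0 d0.
  have b1 : modulus x2 <= 1.
    (* Otherwise the pole [x2^-1] lies in the disc. The points [r%:C * x2^-1] avoid it, and in the
       limit the numerator vanishes there too, forcing [x1 * x2 = x3]. *)
    rewrite leNgt; apply/negP => b1.
    have x20 : x2 != 0 by rewrite -modulus_eq0 gt_eqF // (lt_trans ltr01).
    have : modulus (x3 * x2^-1 - x1) <= modulus (x2 * x2^-1 - 1).
      apply: disc_radial_limit => r r0 r1; apply: h.
        rewrite modulusM modulus_real // modulusV.
        apply: le_lt_trans r1; rewrite ler_piMr // invf_le1 ?(lt_trans ltr01) //.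
        exact: ltW.
      apply: modulus_lt1_ne1.
      by rewrite mulrCA mulfV // mulr1 modulus_real.
    rewrite mulfV // subrr modulus0 => n0.
    have /eqP : modulus (x3 * x2^-1 - x1) = 0 by apply/le_anti; rewrite n0 modulus_ge0.
    rewrite modulus_eq0 subr_eq0 => /eqP n1; move/eqP: E; apply.
    by rewrite -n1 divfK.
  split=> // w w1; apply: h => //; apply: modulus_lt1_ne1; rewrite modulusM.
  by apply: le_lt_trans w1; rewrite ler_piMl ?modulus_ge0.
- have [a1 b1 _] := tetrafeas_le1 _ _ _ _ (proj1 (disc_contractive_feas _ _ _ _) h).
  rewrite normr_le1; split=> //; apply/Hinfnorm_le1P => z z1; rewrite /Psi.
  case: ifP => // _; rewrite modulusM modulusV.
  have := proj2 h z z1; set d := modulus (x2 * z - 1) => nd.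
  (* A zero denominator gives the value 0, which satisfies the bound. *)
  have [->|d0] := eqVneq d 0; first by rewrite invr0 mulr0.
  by rewrite ler_pdivrMr ?mul1r // lt_neqAle eq_sym d0 modulus_ge0.
Qed.

(** * The closure of the tetrablock *)

(** Scaling [z] and [w] by [r] moves the closed bidisc into the open one, where (0) applies. *)
Lemma sub_tetrablock (R : realType) (x1 x2 x3 : R[i]) (r : R) :
  0 <= r < 1 -> disc_contractive x1 x2 x3 ->
  tetrablock (R := R) (r%:C * x1, r%:C * x2, r%:C ^+ 2 * x3).
Proof.
move=> /andP[r0 r1] /cond0_disc h z w; rewrite !normr_le1 => z1 w1.
have := h (r%:C * z) (r%:C * w); rewrite !normr_lt1 !modulusM !modulus_real //.
have -> : 1 - x1 * (r%:C * z) - x2 * (r%:C * w) + x3 * (r%:C * z) * (r%:C * w) =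
  1 - r%:C * x1 * z - r%:C * x2 * w + r%:C ^+ 2 * x3 * z * w by ring.
by apply; apply: le_lt_trans r1; rewrite ler_piMr ?modulus_ge0.
Qed.

Lemma nbhs_triple_ball (R : realType) (x1 x2 x3 : R[i]^o) (B : set (R[i]^o * R[i]^o * R[i]^o)) :
  nbhs (x1, x2, x3) B <->
  exists2 e : R, 0 < e & forall y1 y2 y3 : R[i], modulus (x1 - y1) < e ->
    modulus (x2 - y2) < e -> modulus (x3 - y3) < e -> B (y1, y2, y3).
Proof.
split.
- move=> /nbhs_ballP[e /= e0 eB].
  (* The radius is an element of [R[i]]; being positive, it is real. *)
  have eE : e = (modulus e)%:C by rewrite -normr_modulus gtr0_norm.
  exists (modulus e); first by rewrite -ltcR -eE.
  move=> y1 y2 y3 h1 h2 h3; apply: eB; rewrite eE.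
  by do 2?split; rewrite /= -ball_normE /ball_ /= normr_lt_real.
- move=> [e e0 eB]; apply/nbhs_ballP; exists e%:C => /=; first by rewrite ltcR.
  move=> [[y1 y2] y3] [[]]; rewrite /= -!ball_normE /ball_ /= !normr_lt_real.
  exact: eB.
Qed.

Lemma closure_disc (R : realType) (x1 x2 x3 : R[i]) :
  closure (tetrablock (R := R)) (x1, x2, x3) <-> disc_contractive x1 x2 x3.
Proof.
split=> [h|h B].
- have {}h e : 0 < e -> exists y1 y2 y3 : R[i], [/\ modulus (x1 - y1) < e,
      modulus (x2 - y2) < e, modulus (x3 - y3) < e & disc_contractive y1 y2 y3].
    move=> e0.
    have [|[[y1 y2] y3] [hy [h1 h2 h3]]] := h [set y : R[i]^o * R[i]^o * R[i]^o |
        [/\ modulus (x1 - y.1.1 : R[i]) < e, modulus (x2 - y.1.2 : R[i]) < e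
        & modulus (x3 - y.2 : R[i]) < e]].
      by apply/nbhs_triple_ball; exists e.
    exists y1, y2, y3; split=> //; apply/cond0_disc => z w z1 w1.
    by apply: hy; exact: ltW.
  split=> [|w w1].
    apply/ler_addgt0Pr => e e0; have [y1 [y2 [y3 [_ h2 _ [hy _]]]]] := h e e0.
    have := modulusD R (x2 - y2) y2; rewrite subrK; lra.
  apply/ler_addgt0Pr => e e0.
  (* Passing from [y] to [x] changes three terms, each by at most [e / 3]. *)
  have e30 : 0 < e / 3 by rewrite divr_gt0.
  have [y1 [y2 [y3 [h1 h2 h3 [_ /(_ w w1) hy]]]]] := h (e / 3) e30.
  have le_mul y : modulus y < e / 3 -> modulus (y * w) <= e / 3.
    by move=> ye; rewrite modulusM; have := modulus_ge0 _ y; have := modulus_ge0 _ w; nra.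
  have := modulusD R ((x3 - y3) * w) ((y1 - x1) + (y3 * w - y1)).
  have := modulusD R (y1 - x1) (y3 * w - y1).
  have := modulusD R ((y2 - x2) * w) (x2 * w - 1).
  rewrite modulusB in h2.
  have := le_mul _ h2; have := le_mul _ h3; rewrite modulusB in h1.
  have -> : (y2 - x2) * w + (x2 * w - 1) = y2 * w - 1 by ring.
  have -> : (x3 - y3) * w + (y1 - x1 + (y3 * w - y1)) = x3 * w - x1 by ring.
  lra.
- move=> /nbhs_triple_ball[e e0 eB].
  have [a1 b1 c1] := tetrafeas_le1 _ _ _ _ (proj1 (disc_contractive_feas _ _ _ _) h).
  (* The first two coordinates move by at most [d], the third by at most [2 * d - d ^+ 2 < e];
     [d <= 2^-1] keeps [1 - d] nonnegative. *)
  pose d := Num.min (e / 3) (2^-1).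
  have d0 : 0 < d by rewrite lt_min divr_gt0 //= invr_gt0.
  have de : d <= e / 3 by rewrite ge_min lexx.
  have d2 : d <= 2^-1 by rewrite ge_min lexx orbT.
  exists ((1 - d)%:C * x1, (1 - d)%:C * x2, (1 - d)%:C ^+ 2 * x3); split.
    by apply: sub_tetrablock => //; apply/andP; split; lra.
  have near (k : R) (x : R[i]) : 0 <= k -> k < e -> modulus x <= 1 ->
      modulus (x - (1 - k)%:C * x) < e.
    move=> k0 ke x1'; have -> : x - (1 - k)%:C * x = k%:C * x.
      by rewrite rmorphB rmorph1; ring.
    rewrite modulusM modulus_real //; have := modulus_ge0 _ x; nra.
  apply: eB.
  - by apply: near => //; lra.
  - by apply: near => //; lra.
  - have -> : (1 - d)%:C ^+ 2 = (1 - (2 * d - d ^+ 2))%:C.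
      by rewrite -rmorphXn; congr (_%:C); ring.
    by apply: near => //; nra.
Qed.

(** * Contractive matrices; conditions (7) and (8) *)

Lemma l2norm_ge0 (R : realType) (n : nat) (v : 'cV[R[i]]_n) : 0 <= l2norm v.
Proof. exact: sqrtr_ge0. Qed.

Lemma l2normZ (R : realType) (n : nat) (k : R[i]) (v : 'cV[R[i]]_n) :
  l2norm (k *: v) = modulus k * l2norm v.
Proof.
rewrite /l2norm -[modulus k in RHS]ger0_norm ?modulus_ge0 // -sqrtr_sqr -sqrtrM ?sqr_ge0 //.
by rewrite mulr_sumr; congr Num.sqrt; apply: eq_bigr => i _; rewrite mxE modulusM exprMn.
Qed.

Lemma opnorm_le1P (R : realType) (m n : nat) (A : 'M[R[i]]_(m, n)) :
  (opnorm A <= 1)%E <-> forall v, l2norm (A *m v) <= l2norm v.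
Proof.
split=> [h v|h].
- have {}h u : l2norm u <= 1 -> l2norm (A *m u) <= 1.
    move=> u1; rewrite -lee_fin; apply: le_trans h; apply: ereal_sup_ubound.
    by exists u.
  (* Dividing [v] by [l2norm v + e] instead of [l2norm v] covers [v = 0]. *)
  apply/ler_addgt0Pr => e e0.
  have N0 : 0 < l2norm v + e by rewrite ltr_wpDl ?l2norm_ge0.
  have := h ((l2norm v + e)^-1%:C *: v).
  rewrite -scalemxAr !l2normZ modulus_real ?invr_ge0 ?(ltW N0) //.
  by rewrite ![_^-1 * _]mulrC !ler_pdivrMr // mul1r; apply; rewrite lerDl ltW.
- apply: ge_ereal_sup => _ [v /= v1 <-]; rewrite lee_fin.
  exact: le_trans (h v) v1.
Qed.

Lemma sum_ord2 (V : nmodType) (F : 'I_2 -> V) : \sum_i F i = F 0 + F 1.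
Proof. by rewrite !big_ord_recl big_ord0 addr0; congr (_ + F _); apply/val_inj. Qed.

Lemma sqr_l2norm2 (R : realType) (v : 'cV[R[i]]_2) :
  l2norm v ^+ 2 = modulus (v 0 0) ^+ 2 + modulus (v 1 0) ^+ 2.
Proof. by rewrite /l2norm sum_ord2 sqr_sqrtr // addr_ge0 ?sqr_ge0. Qed.

Lemma det2 (R : comRingType) (A : 'M[R]_2) : \det A = A 0 0 * A 1 1 - A 0 1 * A 1 0.
Proof.
rewrite (expand_det_row _ 0) sum_ord2 /cofactor !det_mx11 !mxE /=.
rewrite expr0 expr1 mul1r mulN1r mulrN.
by congr (_ * A _ _ - _ * A _ _); apply/val_inj.
Qed.

Lemma opnorm2_le1P (R : realType) (A : 'M[R[i]]_2) :
  (opnorm A <= 1)%E <-> forall v0 v1 : R[i],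
    modulus (A 0 0 * v0 + A 0 1 * v1) ^+ 2 + modulus (A 1 0 * v0 + A 1 1 * v1) ^+ 2
      <= modulus v0 ^+ 2 + modulus v1 ^+ 2.
Proof.
have E v : (l2norm (A *m v) <= l2norm v) =
    (modulus (A 0 0 * v 0 0 + A 0 1 * v 1 0) ^+ 2
     + modulus (A 1 0 * v 0 0 + A 1 1 * v 1 0) ^+ 2
      <= modulus (v 0 0) ^+ 2 + modulus (v 1 0) ^+ 2).
  by rewrite -ler_sqr ?nnegrE ?l2norm_ge0 // !sqr_l2norm2 !mxE !sum_ord2.
apply: (iff_trans (opnorm_le1P _ _ _ A)); split=> [h v0 v1|h v]; last by rewrite E.
by have := h (\col_i (if i == 0 then v0 else v1)); rewrite E !mxE.
Qed.

(* A zero (z, w) makes (a12 w, 1 - a11 z) a fixed vector of A diag(z, w), against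
   ||A diag(z, w)|| < 1. *)
Lemma contraction_cond0 (R : realType) (A : 'M[R[i]]_2) (z w : R[i]) :
  (opnorm A <= 1)%E -> `|z| < 1 -> `|w| < 1 ->
  1 - A 0 0 * z - A 1 1 * w + \det A * z * w != 0.
Proof.
rewrite !normr_lt1 => /opnorm2_le1P h z1 w1; apply/eqP; rewrite det2.
set a := A 0 0 in h *; set b := A 0 1 in h *; set c := A 1 0 in h *; set d := A 1 1 in h *.
move=> E.
have a1 : modulus a <= 1.
  have := h 1 0; rewrite !mulr1 !mulr0 !addr0 modulus1 modulus0.
  have := sqr_ge0 (modulus c); have := modulus_ge0 _ a; nra.
have n0 : 1 - a * z != 0.
  rewrite -oppr_eq0 opprB; apply: modulus_lt1_ne1; rewrite modulusM.
  by apply: le_lt_trans z1; rewrite ler_piMl ?modulus_ge0.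
(* [diag(z, w)] makes the fixed vector strictly shorter, since its second entry is nonzero. *)
have := h (z * (b * w)) (w * (1 - a * z)).
have -> : a * (z * (b * w)) + b * (w * (1 - a * z)) = b * w by ring.
have -> : c * (z * (b * w)) + d * (w * (1 - a * z)) = 1 - a * z.
  have -> : c * (z * (b * w)) + d * (w * (1 - a * z)) =
    1 - a * z - (1 - a * z - d * w + (a * d - b * c) * z * w) by ring.
  by rewrite E subr0.
rewrite (modulusM _ z) (modulusM _ w) !exprMn.
have k0 : 0 < modulus (1 - a * z) by rewrite lt_neqAle modulus_ge0 eq_sym modulus_eq0 n0.
have k20 : 0 < modulus (1 - a * z) ^+ 2 by rewrite exprn_gt0.
have z2 : modulus z ^+ 2 < 1 by rewrite exprn_ilt1 ?modulus_ge0.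
have w2 : modulus w ^+ 2 < 1 by rewrite exprn_ilt1 ?modulus_ge0.
have l0 := sqr_ge0 (modulus (b * w)).
nra.
Qed.

(** Positivity of the form with rows [(P, - k)] and [(- k, Q)], by completing the square. *)
Lemma psd_form_ge0 (R : realFieldType) (P Q k x y : R) :
  0 <= P -> 0 <= Q -> 0 <= k -> k ^+ 2 <= P * Q ->
  2 * k * x * y <= P * x ^+ 2 + Q * y ^+ 2.
Proof.
move=> P0 Q0 k0 kPQ; have [PE|P1] := eqVneq P 0.
  have -> : k = 0 by move: kPQ; rewrite PE; nra.
  by rewrite PE; have := mulr_ge0 Q0 (sqr_ge0 y); lra.
have Pp : 0 < P by rewrite lt_neqAle eq_sym P1.
rewrite -subr_ge0 -(pmulr_rge0 _ Pp).
have -> : P * (P * x ^+ 2 + Q * y ^+ 2 - 2 * k * x * y) =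
  (P * x - k * y) ^+ 2 + (P * Q - k ^+ 2) * y ^+ 2 by ring.
by rewrite addr_ge0 ?sqr_ge0 // mulr_ge0 ?sqr_ge0 // subr_ge0.
Qed.

Lemma feas_cond8 (R : realType) (x1 x2 x3 : R[i]) :
  tetrafeas x1 x2 x3 ->
  exists A : 'M[R[i]]_2, A^T = A /\ (opnorm A <= 1)%E /\
    (x1, x2, x3) = (A 0 0, A 1 1, \det A).
Proof.
move=> /cond5_feas; rewrite normr_le1 (@le_real_complex _ (modulus x1 ^+ 2 + modulus x2 ^+ 2
  - modulus x3 ^+ 2 + 2 * modulus (x1 * x2 - x3)) 1) //; last first.
  by rewrite !normr_modulus !real_complexE.
pose s := sqrtc (x1 * x2 - x3); have sE : s ^+ 2 = x1 * x2 - x3 by rewrite sqr_sqrtc.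
have mE : modulus (x1 * x2 - x3) = modulus s ^+ 2 by rewrite -sE expr2 modulusM expr2.
have x3E : x3 = x1 * x2 - s ^+ 2 by rewrite sE; ring.
rewrite mE => -[h c1].
pose A : 'M[R[i]]_2 := \matrix_(i, j) (if i == j then if i == 0 then x1 else x2 else s).
exists A; split; last split.
- by apply/matrixP=> i j; rewrite !mxE eq_sym; case: eqP => // ->.
- apply/opnorm2_le1P => v0 v1; rewrite !mxE /=.
  (* The off-diagonal entry of A* A; [P] and [Q] below are the diagonal entries of 1 - A* A, and
     [SE] computes its determinant. *)
  pose S := x1^* * s + s^* * x2.
  have form : modulus (x1 * v0 + s * v1) ^+ 2 + modulus (s * v0 + x2 * v1) ^+ 2 =
      (modulus x1 ^+ 2 + modulus s ^+ 2) * modulus v0 ^+ 2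
      + (modulus x2 ^+ 2 + modulus s ^+ 2) * modulus v1 ^+ 2
      + 2 * complex.Re (v0^* * v1 * S).
    rewrite !sqr_modulus /S.
    by case: x1 x2 s v0 v1 {x3E S sE mE h A} => [a1 a2] [b1 b2] [s1 s2] [u1 u2] [w1 w2] /=; ring.
  have SE : modulus S ^+ 2 = (1 - modulus x1 ^+ 2 - modulus s ^+ 2)
      * (1 - modulus x2 ^+ 2 - modulus s ^+ 2)
      - (1 - modulus x1 ^+ 2 - modulus x2 ^+ 2 - 2 * modulus s ^+ 2 + modulus x3 ^+ 2).
    rewrite x3E !sqr_modulus /S.
    by case: x1 x2 s {x3E sE mE h A form S} => [a1 a2] [b1 b2] [s1 s2] /=; ring.
  have := Re_le_modulus _ (v0^* * v1 * S); rewrite !modulusM modulus_conj.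
  have c2 : modulus x3 ^+ 2 <= 1 by rewrite expr_le1 ?modulus_ge0.
  have := sqr_ge0 (modulus S).
  set P := 1 - modulus x1 ^+ 2 - _ in SE; set Q := 1 - modulus x2 ^+ 2 - _ in SE.
  move=> S0.
  (* [P] and [Q] are nonnegative because their product is, and their sum is at least [1 - |x3| ^+ 2]
     by (5). *)
  have PQ : 0 <= P * Q by lra.
  have PQ' : 0 <= P + Q by rewrite /P /Q; lra.
  have P0 : 0 <= P by nra.
  have Q0 : 0 <= Q by nra.
  have kPQ : modulus S ^+ 2 <= P * Q by lra.
  have := psd_form_ge0 _ P Q (modulus S) (modulus v0) (modulus v1) P0 Q0 (modulus_ge0 _ S) kPQ.
  rewrite form /P /Q; lra.
- by rewrite det2 !mxE /= x3E expr2.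
Qed.

(** * The linear system of condition (9) *)

Lemma cond6_cond9 (R : realType) (x1 x2 x3 : R[i]) :
  (`|x1 - x2^* * x3| + `|x2 - x1^* * x3| <= 1 - `|x3| ^+ 2 /\
    (`|x3| = 1 -> `|x1| <= 1))
  <-> (`|x3| <= 1 /\ exists b1 b2 : R[i],
       `|b1| + `|b2| <= 1 /\ x1 = b1 + b2^* * x3 /\ x2 = b2 + b1^* * x3).
Proof.
split=> [[h h']|[c1 [b1 [b2 [hb [E1 E2]]]]]].
- have c2 : `|x3| ^+ 2 <= 1.
    by rewrite -subr_ge0; apply: le_trans h; rewrite addr_ge0 ?normr_ge0.
  have c1 : `|x3| <= 1 by rewrite -(@expr_le1 _ 2) ?normr_ge0.
  split=> //; have [c0|c0] := eqVneq `|x3| 1.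
    (* Here the system is singular, but both left-hand terms vanish, so [x2 = x1^* * x3] and the
       pair [x1, 0] solves it. *)
    move: h; rewrite c0 expr1n subrr => h.
    have /eqP : `|x1 - x2^* * x3| + `|x2 - x1^* * x3| = 0.
      by apply/le_anti; rewrite h addr_ge0 ?normr_ge0.
    rewrite paddr_eq0 ?normr_ge0 // !normr_eq0 => /andP[_ /eqP E2].
    exists x1, 0; rewrite normr0 addr0 h' // conjC0 mul0r addr0 add0r; split=> //; split=> //.
    by apply/eqP; rewrite -subr_eq0 E2.
  have u0 : 0 < 1 - `|x3| ^+ 2.
    by rewrite subr_gt0 lt_neqAle c2 pexpr_eq1 ?normr_ge0 // c0.
  have uE : (1 - `|x3| ^+ 2)^* = 1 - `|x3| ^+ 2 by rewrite geC0_conj // ltW.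
  have un : 1 - `|x3| ^+ 2 != 0 by rewrite gt_eqF.
  have key (y1 y2 : R[i]) : y1 = (y1 - y2^* * x3) / (1 - `|x3| ^+ 2)
      + ((y2 - y1^* * x3) / (1 - `|x3| ^+ 2))^* * x3.
    rewrite rmorphM fmorphV /= uE rmorphB rmorphM /= conjCK mulrAC -mulrDl.
    apply: (canRL (mulfK un)); rewrite normCK; ring.
  exists ((x1 - x2^* * x3) / (1 - `|x3| ^+ 2)), ((x2 - x1^* * x3) / (1 - `|x3| ^+ 2)).
  by rewrite !normrM !normfV (gtr0_norm u0) -mulrDl ler_pdivrMr // mul1r; do !split.
(* The same system read backwards: [y2] is eliminated. *)
- have key (y1 y2 : R[i]) : (y1 + y2^* * x3) - (y2 + y1^* * x3)^* * x3
      = y1 * (1 - `|x3| ^+ 2).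
    by rewrite rmorphD rmorphM /= conjCK normCK; ring.
  have u0 : 0 <= 1 - `|x3| ^+ 2 by rewrite subr_ge0 expr_le1 ?normr_ge0.
  split; first by rewrite E1 E2 !key !normrM (ger0_norm u0) -mulrDl ler_piMl.
  move=> _; rewrite E1; apply: le_trans hb; apply: le_trans (ler_normD _ _) _.
  by rewrite lerD2l normrM norm_conjC ler_piMr.
Qed.

(** * The cycle of implications *)

Theorem theorem2p4 (R : realType) (x1 x2 x3 : R[i]) :
  [<-> (* 0 *)
       forall z w : R[i], `|z| < 1 -> `|w| < 1 ->
         1 - x1 * z - x2 * w + x3 * z * w != 0;
       (* 1 *)
       closure (tetrablock (R := R)) (x1, x2, x3);
       (* 2 *)
       (Hinfnorm (Psi x1 x2 x3) <= 1)%E /\ (x1 * x2 = x3 -> `|x2| <= 1);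
       (* 2' *)
       (Hinfnorm (Upsilon x1 x2 x3) <= 1)%E /\ (x1 * x2 = x3 -> `|x1| <= 1);
       (* 3 *)
       `|x1 - x2^* * x3| + `|x1 * x2 - x3| <= 1 - `|x2| ^+ 2 /\
         (x1 * x2 = x3 -> `|x1| <= 1);
       (* 3' *)
       `|x2 - x1^* * x3| + `|x1 * x2 - x3| <= 1 - `|x1| ^+ 2 /\
         (x1 * x2 = x3 -> `|x2| <= 1);
       (* 4 *)
       `|x1| ^+ 2 - `|x2| ^+ 2 + `|x3| ^+ 2 + 2 * `|x2 - x1^* * x3| <= 1 /\
         `|x2| <= 1;
       (* 4' *)
       - `|x1| ^+ 2 + `|x2| ^+ 2 + `|x3| ^+ 2 + 2 * `|x1 - x2^* * x3| <= 1 /\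
         `|x1| <= 1;
       (* 5 *)
       `|x1| ^+ 2 + `|x2| ^+ 2 - `|x3| ^+ 2 + 2 * `|x1 * x2 - x3| <= 1 /\
         `|x3| <= 1;
       (* 6 *)
       `|x1 - x2^* * x3| + `|x2 - x1^* * x3| <= 1 - `|x3| ^+ 2 /\
         (`|x3| = 1 -> `|x1| <= 1);
       (* 7 *)
       exists A : 'M[R[i]]_2,
         (opnorm A <= 1)%E /\ (x1, x2, x3) = (A 0 0, A 1 1, \det A);
       (* 8 *)
       exists A : 'M[R[i]]_2,
         A^T = A /\
         (opnorm A <= 1)%E /\ (x1, x2, x3) = (A 0 0, A 1 1, \det A);
       (* 9 *)
       `|x3| <= 1 /\
         exists b1 b2 : R[i],
           `|b1| + `|b2| <= 1 /\
           x1 = b1 + b2^* * x3 /\ x2 = b2 + b1^* * x3].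
Proof.
(* Conditions (0) to (6) are each equivalent to [tetrafeas x1 x2 x3]; the primed ones use its
   symmetry in [x1] and [x2]. *)
have H0 := iff_trans (cond0_disc R x1 x2 x3) (disc_contractive_feas R x1 x2 x3).
have H1 := iff_trans (closure_disc R x1 x2 x3) (disc_contractive_feas R x1 x2 x3).
have H2 := iff_trans (cond2_disc R x1 x2 x3) (disc_contractive_feas R x1 x2 x3).
have H2' := iff_trans (iff_trans (cond2_disc R x2 x1 x3)
  (disc_contractive_feas R x2 x1 x3)) (tetrafeasC R x2 x1 x3).
have H3 := cond3_feas R x1 x2 x3.
have H3' := iff_trans (cond3_feas R x2 x1 x3) (tetrafeasC R x2 x1 x3).
have H4 := cond4_feas R x1 x2 x3.
have H4' := iff_trans (cond4_feas R x2 x1 x3) (tetrafeasC R x2 x1 x3).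
have H5 := cond5_feas R x1 x2 x3.
have H6 := cond6_feas R x1 x2 x3.
have H9 := cond6_cond9 R x1 x2 x3.
rewrite [x2 * x1]mulrC in H2' H3'; rewrite [_ - `|x1| ^+ 2]addrC in H4'.
split; [|split; [|split; [|split; [|split; [|split; [|split; [|split; [|split;
  [|split; [|split; [|split]]]]]]]]]]].
- by move=> /H0/H1.
- by move=> /H1/H2.
- by move=> /H2/H2'.
- by move=> /H2'/H3.
- by move=> /H3/H3'.
- by move=> /H3'/H4.
- by move=> /H4/H4'.
- by move=> /H4'/H5.
- by move=> /H5/H6.
- by move=> /H6/feas_cond8[A [_ hA]]; exists A.
(* The given [A] may fail to be symmetric, so a new matrix is built by way of (0). *)
- move=> [A [hA [-> -> ->]]]; apply: feas_cond8; apply/disc_contractive_feas/cond0_disc.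
  by move=> z w; exact: contraction_cond0.
- move=> [A [_ [hA xE]]]; apply/H9/H6/H0 => z w; case: xE => -> -> ->.
  exact: contraction_cond0.
- by move=> /H9/H6/H0.
Qed.
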